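(* Let $\mathbb{F}$ be a field and let $\Xi\subset\mathbb{F}^2$ be a $y$-tower set, written as $\Xi=\{(\mathrm{x}(i),\mathrm{y}(\sigma_i^y(j))):(i,j)\in S_y(\Xi)\}$ with $\mathrm{x},\mathrm{y},\sigma_i^y$ as in the definition of $y$-tower. For $(i,j)\in S_y(\Xi)$ set $$\phi_{ij}^y:=c_{ij}^y\prod_{s=0}^{i-1}(x-\mathrm{x}(s))\prod_{t=0}^{j-1}(y-\mathrm{y}(\sigma_i^y(t))),\qquad c_{ij}^y=\frac{1}{\prod_{s=0}^{i-1}(\mathrm{x}(i)-\mathrm{x}(s))\prod_{t=0}^{j-1}(\mathrm{y}(\sigma_i^y(j))-\mathrm{y}(\sigma_i^y(t)))}\in\mathbb{F},$$ where empty products are taken as $1$. Then $\mathfrak{N}_{S_y(\Xi)}:=\{\phi_{ij}^y:(i,j)\in S_y(\Xi)\}$ is a Newton interpolation basis for $\mathcal{P}_{\prec_{\mathrm{grevlex}}}(\Xi)$ satisfying $$\phi_{ij}^y(\mathrm{x}(m),\mathrm{y}(\sigma_m^y(n)))=\delta_{(i,j),(m,n)},\qquad (i,j)\succeq_{\mathrm{lex}}(m,n),$$ for $(i,j),(m,n)\in S_y(\Xi)$.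
   Context: $\mathbb{N}_0$ is the set of nonnegative integers and $\Pi^2=\mathbb{F}[x,y]$. For a finite nonempty $\Xi\subset\mathbb{F}^2$, $\mathcal{I}(\Xi)\subset\Pi^2$ is the ideal of polynomials vanishing on $\Xi$. For a monomial order $\prec$, $\mathcal{N}_\prec(\mathcal{I}(\Xi))$ is the set of monomials not divisible by the leading monomial of any element of the reduced Gröbner basis of $\mathcal{I}(\Xi)$ w.r.t. $\prec$, and $\mathcal{P}_\prec(\Xi)=\mathrm{Span}_{\mathbb{F}}\mathcal{N}_\prec(\mathcal{I}(\Xi))$. Orders: $x^iy^j\prec_{\mathrm{grevlex}}x^my^n$ iff $i+j<m+n$, or $i+j=m+n$ and $j>n$; $(i,j)\prec_{\mathrm{lex}}(m,n)$ iff $i<m$, or $i=m$ and $j<n$. Newton interpolation basis: for nonzero polynomials $f,g\in\Pi^2$, write $f\prec g$ if the leading monomial of $f$ w.r.t. $\prec$ is $\prec$-smaller than that of $g$. Let $\Xi=\{\xi^{(0)},\xi^{(1)},\ldots,\xi^{(\mu-1)}\}\subset\mathbb{F}^2$ be a finite nonempty set of $\mu$ points and $\prec$ a fixed monomial order. If a subset $\{p_0,p_1,\ldots,p_{\mu-1}\}\subset\mathcal{P}_\prec(\Xi)$ with $p_0\prec p_1\prec\cdots\prec p_{\mu-1}$ satisfies $p_j(\xi^{(i)})=\delta_{ij}$ for $0\le i\le j\le\mu-1$, then it is called a Newton interpolation basis for $\mathcal{P}_\prec(\Xi)$. A finite nonempty $\mathcal{A}\subset\mathbb{N}_0^2$ is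 lower if $(i,j)\in\mathcal{A}$, $0\le i'\le i$, $0\le j'\le j$ imply $(i',j')\in\mathcal{A}$; $\mathrm{b}_x(\mathcal{A})=\max\{i:(i,0)\in\mathcal{A}\}$, $\mathrm{b}_y(\mathcal{A})=\max\{j:(0,j)\in\mathcal{A}\}$. For a nonincreasing sequence of nonnegative integers, $\mathrm{L}_y(n_0,\ldots,n_b)=\{(i,j):0\le i\le b,\ 0\le j\le n_i\}$. Every lower set can be written uniquely in this form; it is $y$-strict if $n_0,n_1,\ldots$ is strictly decreasing. $\pi_x$ is the projection onto the first coordinate. Let $\Xi_0^y,\ldots,\Xi_{\#\pi_x(\Xi)-1}^y$ be the sets $\Xi\cap\{x=\bar x\}$, $\bar x\in\pi_x(\Xi)$, enumerated with nonincreasing cardinalities, and put $S_y(\Xi)=\mathrm{L}_y(\#\Xi_0^y-1,\ldots,\#\Xi_{\#\pi_x(\Xi)-1}^y-1)$. A finite nonempty $\Xi\subset\mathbb{F}^2$ is $y$-tower if $S_y(\Xi)$ is $y$-strict and there are two injective functions $\mathrm{x},\mathrm{y}:\mathbb{N}_0\to\mathbb{F}$ and permutations $\sigma_0^y,\ldots,\sigma_{\mathrm{b}_x(S_y(\Xi))}^y$ of $\{0,1,\ldots,\mathrm{b}_y(S_y(\Xi))\}$ with $\Xi=\{(\mathrm{x}(i),\mathrm{y}(\sigma_i^y(j))):(i,j)\in S_y(\Xi)\}$.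
   Formalization: The Newton basis condition p_j(ξ^(i))=δ_ij (i≤j) is required along the lex-increasing enumeration of the φ_ij instead of the grevlex one, along which it can fail for every labelling of Ξ; membership in P_grevlex and the strict grevlex chain are kept. *)

(* Defs.v *)
From HB Require Import structures.
From mathcomp Require Import all_boot all_order all_fingroup all_algebra.
From mathcomp Require Import finmap mpoly.

Set Implicit Arguments.
Unset Strict Implicit.
Unset Printing Implicit Defensive.

Import GRing.Theory.
Local Open Scope fset_scope.
Local Open Scope ring_scope.

(* The monomial x^i y^j is the pair (i, j); a monomial order is given by its
   strict part, a [rel (nat * nat)]. *)

Definition grevlex : rel (nat * nat) := fun u v =>
  ((u.1 + u.2 < v.1 + v.2) || ((u.1 + u.2 == v.1 + v.2) && (v.2 < u.2)))%N.

Definition lex : rel (nat * nat) := fun u v =>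
  ((u.1 < v.1) || ((u.1 == v.1) && (u.2 < v.2)))%N.

Definition mon_divides (u v : nat * nat) : bool :=
  ((u.1 <= v.1) && (u.2 <= v.2))%N.

Section Polynomials.
Variable F : fieldType.
Implicit Types (p q f g : {mpoly F[2]}) (Xi : {fset F * F}).
Implicit Types (prec enum : rel (nat * nat)).

Definition varx : {mpoly F[2]} := 'X_0.
Definition vary : {mpoly F[2]} := 'X_1.

Definition mon (u : nat * nat) : {mpoly F[2]} := varx ^+ u.1 * vary ^+ u.2.

Definition evalp p (xi : F * F) : F := p.@[tnth [tuple xi.1; xi.2]].

Definition supp p : seq (nat * nat) := [seq (m 0, m 1) | m : 'X_{1..2} <- msupp p].

(* Meaningful for p != 0; (0, 0) is the least element of any monomial order. *)
Definition lead prec p : nat * nat :=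
  foldr (fun u v => if prec u v then v else u) (0, 0)%N (supp p).

Definition lead_coeff prec p : F :=
  p@_[multinom tnth [tuple (lead prec p).1; (lead prec p).2] k | k < 2].

Definition poly_lt prec : rel {mpoly F[2]} := fun f g =>
  [&& f != 0, g != 0 & prec (lead prec f) (lead prec g)].

Definition vanishing_ideal Xi p : Prop := forall xi, xi \in Xi -> evalp p xi = 0.

Definition groebner_basis prec (I : {mpoly F[2]} -> Prop)
    (G : {fset {mpoly F[2]}}) : Prop :=
  (forall g, g \in G -> g != 0 /\ I g) /\
  (forall f, I f -> f != 0 ->
     exists2 g, g \in G & mon_divides (lead prec g) (lead prec f)).

Definition reduced_groebner_basis prec (I : {mpoly F[2]} -> Prop)
    (G : {fset {mpoly F[2]}}) : Prop :=
  [/\ groebner_basis prec I G,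
      forall g, g \in G -> lead_coeff prec g = 1
    & forall g h, g \in G -> h \in G -> g != h ->
        forall u, u \in supp g -> ~~ mon_divides (lead prec h) u].

Definition normal_monomial prec (I : {mpoly F[2]} -> Prop) (u : nat * nat) : Prop :=
  exists G, reduced_groebner_basis prec I G /\
    forall g, g \in G -> ~~ mon_divides (lead prec g) u.

Definition interp_space prec Xi p : Prop :=
  exists2 s : seq (F * (nat * nat)),
    (forall cu, cu \in s -> normal_monomial prec (vanishing_ideal Xi) cu.2)
  & p = \sum_(cu <- s) cu.1 *: mon cu.2.

Definition newton_basis prec Xi (B : {fset {mpoly F[2]}}) : Prop :=
  [/\ #|` B| = #|` Xi|,
      forall p, p \in B -> interp_space prec Xi p
    & exists (xi : seq (F * F)) (p : seq {mpoly F[2]}),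
        [/\ perm_eq xi Xi, perm_eq p B, sorted (poly_lt prec) p &
            forall i j, (i <= j < #|` Xi|)%N ->
              evalp (nth 0 p j) (nth (0, 0) xi i) = (i == j)%:R]].

(* As [newton_basis prec], except that the triangular condition
   p_j(xi^(i)) = delta_ij (i <= j) is required for the enumeration of B that is
   increasing for [enum]; B is still a [prec]-chain.  For the bases built from
   y-tower sets, whose points are indexed lexicographically, the condition
   fails along the grevlex enumeration: with x(k) = y(k) = k, sections of
   3, 2, 1 points, sigma_0 = id and sigma_1 = (0 -> 2, 1 -> 0, 2 -> 1), the
   grevlex enumeration is phi_00, phi_01, phi_10, phi_02, phi_11, phi_20, and
   phi_10(xi^(2)) = 1 forces xi^(2) = (1, 2) or (1, 0), where respectively
   phi_02 and phi_11 take the value 1 instead of 0. *)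
Definition newton_basis_along prec enum Xi (B : {fset {mpoly F[2]}}) : Prop :=
  [/\ #|` B| = #|` Xi|,
      forall p, p \in B -> interp_space prec Xi p,
      exists2 q : seq {mpoly F[2]}, perm_eq q B & sorted (poly_lt prec) q
    & exists (xi : seq (F * F)) (p : seq {mpoly F[2]}),
        [/\ perm_eq xi Xi, perm_eq p B, sorted (poly_lt enum) p &
            forall i j, (i <= j < #|` Xi|)%N ->
              evalp (nth 0 p j) (nth (0, 0) xi i) = (i == j)%:R]].

Lemma newton_basis_along_diag prec Xi B :
  newton_basis_along prec prec Xi B <-> newton_basis prec Xi B.
Proof.
split; first by case.
by case=> cardB subB [xi [p [? ? ? ?]]]; split=> //; [exists p | exists xi, p].
Qed.

End Polynomials.

Arguments mon {F} u.

Definition Ly (ns : seq nat) : {fset nat * nat} :=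
  [fset u in [seq (i, j) | i <- iota 0 (size ns), j <- iota 0 (nth 0%N ns i).+1]].

Definition bx (A : {fset nat * nat}) : nat := (\max_(u <- A | u.2 == 0) u.1)%N.
Definition by_ (A : {fset nat * nat}) : nat := (\max_(u <- A | u.1 == 0) u.2)%N.

Definition y_strict (A : {fset nat * nat}) : Prop :=
  exists ns : seq nat, [/\ ns != [::], A = Ly ns & sorted gtn ns].

Section Tower.
Variable F : fieldType.
Implicit Types (Xi : {fset F * F}) (x y : nat -> F).

Definition proj_x Xi : {fset F} := [fset p.1 | p in Xi].

Definition column Xi (a : F) : {fset F * F} := [fset p in Xi | p.1 == a].

Definition column_sizes Xi : seq nat :=
  sort geq [seq #|` column Xi a| | a <- proj_x Xi].

Definition Sy Xi : {fset nat * nat} := Ly [seq n.-1 | n <- column_sizes Xi].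

(* sigma_i(j) as a natural number; [inord] is exact for i <= bx and j <= b_y,
   hence at every (i, j) in Sy Xi. *)
Definition sig b c (sigma : 'I_b.+1 -> 'S_c.+1) (i j : nat) : nat :=
  sigma (inord i) (inord j).

Definition tower_point b c x y (sigma : 'I_b.+1 -> 'S_c.+1) (u : nat * nat) : F * F :=
  (x u.1, y (sig sigma u.1 u.2)).

Definition y_tower_form Xi x y
    (sigma : 'I_(bx (Sy Xi)).+1 -> 'S_(by_ (Sy Xi)).+1) : Prop :=
  [/\ injective x, injective y & Xi = [fset tower_point x y sigma u | u in Sy Xi]].

Definition y_tower Xi : Prop :=
  [/\ Xi != fset0, y_strict (Sy Xi) & exists x y sigma, @y_tower_form Xi x y sigma].

Definition phi_coeff b c x y (sigma : 'I_b.+1 -> 'S_c.+1) (i j : nat) : F :=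
  ((\prod_(s < i) (x i - x s)) *
   (\prod_(t < j) (y (sig sigma i j) - y (sig sigma i t))))^-1.

Definition phi b c x y (sigma : 'I_b.+1 -> 'S_c.+1) (i j : nat) : {mpoly F[2]} :=
  phi_coeff x y sigma i j *:
  ((\prod_(s < i) (varx F - (x s)%:MP)) *
   (\prod_(t < j) (vary F - (y (sig sigma i t))%:MP))).

Definition newton_family b c x y (sigma : 'I_b.+1 -> 'S_c.+1)
    (A : {fset nat * nat}) : {fset {mpoly F[2]}} :=
  [fset phi x y sigma u.1 u.2 | u in A].

End Tower.

(* Main.v *)
(* Write S = S_y(Xi) and let N k be the height of its column k, so that N is
   strictly decreasing while positive. The values of the phi_ij are triangular
   along the lexicographic order, so the only issue is that S is the set of
   normal monomials of I(Xi) for grevlex.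
   - A nonzero f in I(Xi) has no leading monomial x^i y^j in S: its degree
     i + j is less than N 0 by strictness, so f vanishes on the whole line
     x = x(0). This is absurd for i = 0; otherwise x - x(0) divides f and
     induction on i applies to the quotient.
   - For every k there is f_k in I(Xi) with leading monomial x^k y^(N k) and all
     other monomials in S: start from the nodal product with this leading
     monomial, which vanishes on the columns up to k, and interpolate it on the
     later columns by the phi_ij with i > k, whose degree satisfies
     i + j < i + N i <= k + N k.
   These f_k therefore form the reduced Groebner basis. *)

Require Import Defs.
From HB Require Import structures.
From mathcomp Require Import all_boot all_order all_fingroup all_algebra.
From mathcomp Require Import finmap mpoly zify.

Set Implicit Arguments.
Unset Strict Implicit.
Unset Printing Implicit Defensive.

Import GRing.Theory.
Local Open Scope fset_scope.
Local Open Scope ring_scope.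

(** * Monomial orders on exponent pairs *)

Definition admissible (prec : rel (nat * nat)) : Prop :=
  [/\ irreflexive prec, transitive prec,
      forall u v, u != v -> prec u v || prec v u
    & forall u v, mon_divides u v -> u != v -> prec u v].

Lemma grevlex_admissible : admissible grevlex.
Proof.
rewrite /grevlex; split.
- by case=> a b /=; lia.
- by case=> a b [c d] [e f] /=; lia.
- by case=> a b [c d] /=; rewrite xpair_eqE; lia.
- by case=> a b [c d]; rewrite /mon_divides /= xpair_eqE; lia.
Qed.

Lemma lex_admissible : admissible lex.
Proof.
rewrite /lex; split.
- by case=> a b /=; lia.
- by case=> a b [c d] [e f] /=; lia.
- by case=> a b [c d] /=; rewrite xpair_eqE; lia.
- by case=> a b [c d]; rewrite /mon_divides /= xpair_eqE; lia.
Qed.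

Lemma exists_sorted_perm prec (s : seq (nat * nat)) :
  admissible prec -> uniq s -> exists2 t, perm_eq t s & sorted prec t.
Proof.
case=> irr tr tot _ us; pose le u v := (u == v) || prec u v.
have le_tot : total le.
  by move=> u v; rewrite /le (eq_sym v); case: eqVneq => //= /tot.
have le_tr : transitive le.
  move=> v u w /orP[/eqP->//|uv] /orP[/eqP<-|vw]; rewrite /le ?uv ?orbT //.
  by rewrite (tr _ _ _ uv vw) orbT.
exists (sort le s); first by rewrite perm_sort.
have := sort_sorted le_tot s; rewrite !sorted_pairwise //.
have := sort_uniq le s; rewrite us uniq_pairwise => ne lep.
have := pairwise_relI le [rel x y | x != y] (sort le s); rewrite lep ne /=.
by apply: sub_pairwise => u v /= /andP[/orP[/eqP->|//]]; rewrite eqxx.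
Qed.

(** * Supports, leading monomials and the passage to F[y][x] *)

Section Bivariate.
Variable F : fieldType.
Implicit Types (p q f g : {mpoly F[2]}) (u v : nat * nat).

Definition mnm u : 'X_{1..2} := [multinom tnth [tuple u.1; u.2] k | k < 2].

Lemma mnmK : cancel mnm (fun m : 'X_{1..2} => (m 0, m 1)).
Proof. by case=> a b; rewrite !mnmE. Qed.

Lemma mnm_of (m : 'X_{1..2}) : mnm (m 0, m 1) = m.
Proof.
apply/mnmP => k; rewrite mnmE.
by case: k => -[|[|//]] lt; congr (m _); apply/val_inj.
Qed.

Lemma in_supp p u : (u \in supp p) = (p@_(mnm u) != 0).
Proof.
rewrite -mcoeff_msupp; apply/mapP/idP => [[m mp ->]|mp].
  by rewrite mnm_of.
by exists (mnm u); rewrite ?mnmK.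
Qed.

Section Lead.
Variables (prec : rel (nat * nat)) (prec_adm : admissible prec).

Lemma foldr_max_ge (s : seq (nat * nat)) u :
  let w := foldr (fun u v => if prec u v then v else u) (0, 0)%N s in
  u \in s -> (u == w) || prec u w.
Proof.
case: prec_adm => irr tr tot _; elim: s => //= v s IHs.
set w := foldr _ _ _ in IHs *; rewrite inE => /orP[/eqP->|/IHs {IHs}].
  by case: ifP => [->|]; rewrite ?eqxx ?orbT.
case: ifP => // nvw /orP[/eqP->|uw].
  by case: eqVneq => //= /tot; rewrite nvw orbF.
case: (eqVneq v w) => [->|/tot]; first by rewrite uw orbT.
by rewrite nvw /= => /(tr _ _ _ uw) ->; rewrite orbT.
Qed.

Lemma foldr_max_mem (s : seq (nat * nat)) : s != [::] ->
  foldr (fun u v => if prec u v then v else u) (0, 0)%N s \in s.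
Proof.
case: prec_adm => irr tr tot dv; elim: s => //= v s IHs _.
case: ifP => [vw|]; last by rewrite mem_head.
rewrite inE; case: s => [|v' s] in IHs vw *; last by rewrite IHs ?orbT.
(* On a singleton the fold returns its seed only if the entry is below (0, 0), which is impossible
   because (0, 0) divides every monomial. *)
move: vw => /= v0; suff : prec (0, 0)%N (0, 0)%N by rewrite irr.
case: (eqVneq (0, 0)%N v) => [e|/dv v1]; first by rewrite -{1}e in v0.
by apply: tr v0; apply: v1.
Qed.

Lemma lead_ge p u : u \in supp p -> (u == lead prec p) || prec u (lead prec p).
Proof. exact: foldr_max_ge. Qed.

Lemma lead_supp p : p != 0 -> lead prec p \in supp p.
Proof.
move=> p0; apply: foldr_max_mem.
by rewrite -size_eq0 size_map size_eq0 msupp_eq0.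
Qed.

Lemma lead_unique p u : u \in supp p ->
  (forall v, v \in supp p -> (v == u) || prec v u) -> lead prec p = u.
Proof.
case: prec_adm => irr tr _ _ up ub.
have p0 : p != 0 by apply: contraTneq up => ->; rewrite in_supp mcoeff0 eqxx.
have /orP[/eqP->//|lu] := ub _ (lead_supp p0).
have /orP[/eqP->//|ul] := lead_ge up.
by have := tr _ _ _ lu ul; rewrite irr.
Qed.

End Lead.

(** The outer variable is x and the inner one y, so evaluation at a constant restricts to a vertical
    line. *)
Definition biv p : {poly {poly F}} :=
  mmap (polyC \o polyC) (fun k : 'I_2 => if k == 0 then 'X else 'X%:P) p.

Lemma bivE p : biv p =
  \sum_(m <- msupp p) (p@_m)%:P%:P * ('X^(m 0) * ('X^(m 1))%:P).
Proof.
apply: eq_bigr => m _; rewrite /mmap1 !big_ord_recl big_ord0 /= mulr1.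
rewrite -polyC_exp; congr (_ * (_ * ('X^(m _))%:P)); exact: val_inj.
Qed.

Lemma biv_coef p a b : (biv p)`_a`_b = p@_(mnm (a, b)).
Proof.
rewrite bivE coef_sum coef_sum [in RHS](mpolyE p) raddf_sum /=.
apply: eq_bigr => m _; rewrite mcoeffZ mcoeffX coefCM coefCM coefMC coefXn.
congr (_ * _); rewrite -[in RHS](mnm_of m).
rewrite (can_eq mnmK) xpair_eqE (eq_sym a).
by case: eqP => _; rewrite ?mul0r ?coef0 // mul1r coefXn (eq_sym b).
Qed.

Lemma evalp_biv p (xi : F * F) : evalp p xi = (biv p).[xi.1%:P].[xi.2].
Proof.
rewrite /evalp mevalE bivE !horner_sum; apply: eq_bigr => m _.
rewrite !hornerE !big_ord_recl big_ord0 /= mulr1 mulrA.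
by congr (_ * _ * xi.2 ^+ m _); apply: val_inj.
Qed.

End Bivariate.

(** * Products of linear factors in x and in y *)

Section NodalProducts.
Variable F : fieldType.
Implicit Types (f g : nat -> F) (i j a b : nat).

Definition nodal f i g j : {mpoly F[2]} :=
  (\prod_(s < i) (varx F - (f s)%:MP)) * (\prod_(t < j) (vary F - (g t)%:MP)).

Definition uninodal f i : {poly F} := \prod_(s < i) ('X - (f s)%:P).

Lemma size_uninodal f i : size (uninodal f i) = i.+1.
Proof.
rewrite /uninodal -(big_mkord xpredT (fun s => 'X - (f s)%:P)).
by rewrite size_prod_XsubC size_iota subn0.
Qed.

Lemma nodal_coef f i g j a b :
  (nodal f i g j)@_(mnm (a, b)) = (uninodal f i)`_a * (uninodal g j)`_b.
Proof.
suff -> : (nodal f i g j)@_(mnm (a, b)) =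
    (map_poly polyC (uninodal f i) * (uninodal g j)%:P)`_a`_b.
  by rewrite coefMC coef_map coefCM.
rewrite -biv_coef /biv rmorphM !rmorph_prod /=.
congr ((_ * _ : {poly {poly F}})`_a`_b).
  by apply: eq_bigr => s _;
    rewrite rmorphB /= mmapC mmapX mmap1U rmorphB /= map_polyX map_polyC.
by apply: eq_bigr => s _; rewrite rmorphB /= mmapC mmapX mmap1U /= rmorphB.
Qed.

Lemma nodal_supp f i g j u : u \in supp (nodal f i g j) -> mon_divides u (i, j).
Proof.
case: u => a b; rewrite in_supp nodal_coef /mon_divides /=.
apply: contraNT; rewrite negb_and -!ltnNge => /orP[ia|jb].
  by rewrite nth_default ?mul0r // size_uninodal.
by rewrite [X in _ * X]nth_default ?mulr0 // size_uninodal.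
Qed.

Lemma nodal_lead_coef f i g j : (nodal f i g j)@_(mnm (i, j)) = 1.
Proof.
have lead1 h k : (uninodal h k)`_k = 1.
  have /monicP := monic_prod_XsubC (index_enum 'I_k) xpredT
    (fun s : 'I_k => h s).
  by rewrite /lead_coef -/(uninodal h k) size_uninodal.
by rewrite nodal_coef !lead1 mulr1.
Qed.

Lemma nodal_eval f i g j (xi : F * F) : evalp (nodal f i g j) xi =
  (\prod_(s < i) (xi.1 - f s)) * (\prod_(t < j) (xi.2 - g t)).
Proof.
rewrite /evalp mevalM !rmorph_prod /=.
by congr (_ * _); apply: eq_bigr => s _; rewrite mevalB mevalC mevalXU.
Qed.

End NodalProducts.

(** * Polynomials of low degree vanishing on vertical lines *)

Lemma vanishing_on_line (F : fieldType) (a : F) (rs : seq F) (d : nat)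
    (P : {poly {poly F}}) :
  uniq rs -> (d < size rs)%N -> (forall r, r \in rs -> P.[a%:P].[r] = 0) ->
  (forall k l, (d < k + l)%N -> P`_k`_l = 0) -> P.[a%:P] = 0.
Proof.
move=> urs srs root0 deg; apply/eqP/negPn/negP => nz.
have roots : all (root P.[a%:P]) rs by apply/allP => r /root0 /eqP.
have := max_poly_roots nz roots urs; rewrite ltnNge => /negP; apply.
apply: leq_trans srs; apply/leq_sizeP => l l_gt.
rewrite horner_coef coef_sum big1 // => k _.
by rewrite -polyC_exp coefMC deg ?mul0r //; lia.
Qed.

(** The last two hypotheses say that no monomial of P exceeds x^i y^j in grevlex. Dividing by x -
    x(0) lowers i by one and drops column 0, which preserves all hypotheses. *)
Lemma vanishing_lead_coef (F : fieldType) (x : nat -> F) (rs : nat -> seq F)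
    (i j : nat) (P : {poly {poly F}}) :
  injective x ->
  (forall k, (k <= i)%N -> uniq (rs k) /\ (i - k + j < size (rs k))%N) ->
  (forall k r, (k <= i)%N -> r \in rs k -> P.[(x k)%:P].[r] = 0) ->
  (forall a b, (i + j < a + b)%N -> P`_a`_b = 0) ->
  (forall a b, (i < a)%N -> (a + b = i + j)%N -> P`_a`_b = 0) ->
  P`_i`_j = 0.
Proof.
elim: i x rs P => [|i IHi] x rs P x_inj rsP root0 deg top.
all: have [urs srs] := rsP _ (leq0n _); rewrite subn0 in srs.
all: have line0 := vanishing_on_line urs srs (fun r => root0 _ r (leq0n _)) deg.
(* Case i = 0: the degree bound kills P[_a]_j for a > 0, so only P[_0]_j remains on the line. *)
- have := congr1 (fun p : {poly F} => p`_j) line0.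
  have [s0 _|sP] := posnP (size P).
    by rewrite [P`_0]nth_default ?coef0 // s0.
  rewrite horner_coef coef_sum coef0 -(prednK sP) big_ord_recl big1 ?addr0.
    by rewrite expr0 mulr1.
  by move=> a _; rewrite -polyC_exp coefMC deg ?mul0r // lift0; lia.
have /factor_theorem[Q defP] : root P (x 0%N)%:P by apply/eqP.
have recQ a b : Q`_a`_b = P`_a.+1`_b + x 0%N * Q`_a.+1`_b.
  by rewrite defP mulrBr coefB coefMX /= coefMC coefB coefMC mulrC subrK.
(* Downward induction on a from the size of Q, since [recQ] expresses each coefficient through the
   next one. *)
have degQ a b : (i + j < a + b)%N -> Q`_a`_b = 0.
  have [n] := ubnP (size Q - a); elim: n a => // n IHn a.
  case: (leqP (size Q) a) => [sa _ _|sa sn ab].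
    by rewrite [Q`_a]nth_default ?coef0.
  by rewrite recQ deg ?IHn ?mulr0 ?addr0 //; lia.
have := recQ i j; rewrite (degQ i.+1) ?mulr0 ?addr0; last by lia.
move=> <-; apply: (IHi (fun k => x k.+1) (fun k => rs k.+1)) => //.
- by move=> k l /x_inj[].
- by move=> k ki; have := rsP k.+1 ki.
- move=> k r ki /(root0 k.+1 r ki)/eqP.
  rewrite defP !hornerE mulf_eq0 => /orP[/eqP//|].
  by rewrite subr_eq0 => /eqP/x_inj.
- by move=> a b ia ab; rewrite recQ top ?degQ ?mulr0 ?addr0 //; lia.
Qed.

(** * Triangular interpolation and the interpolation space *)

Section Interpolation.
Variable F : fieldType.
Implicit Types (p q : {mpoly F[2]}) (Xi : {fset F * F}).

Lemma evalpB p q (xi : F * F) : evalp (p - q) xi = evalp p xi - evalp q xi.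
Proof. exact: mevalB. Qed.

Lemma evalpZ c p (xi : F * F) : evalp (c *: p) xi = c * evalp p xi.
Proof. exact: mevalZ. Qed.

Lemma evalp_sum (I : Type) (r : seq I) (G : I -> {mpoly F[2]}) (xi : F * F) :
  evalp (\sum_(k <- r) G k) xi = \sum_(k <- r) evalp (G k) xi.
Proof. exact: raddf_sum. Qed.

(** Subtracting a multiple of [psi u] corrects the value at the first point u; the later [psi v]
    vanish there, so correcting the remaining points does not disturb it. *)
Lemma triangular_interpolation (T : eqType) (s : seq T) (pt : T -> F * F)
    (psi : T -> {mpoly F[2]}) p :
  uniq s -> {in s, forall u, evalp (psi u) (pt u) = 1} ->
  pairwise (fun u v => evalp (psi v) (pt u) == 0) s ->
  exists c : T -> F, {in s, forall u,
    evalp (p - \sum_(v <- s) c v *: psi v) (pt u) = 0}.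
Proof.
elim: s p => [|u s IHs] p /=; first by exists (fun=> 0).
move=> /andP[us uqs] psi1 /andP[psi0 pws].
have [w sw|c cP] := IHs (p - evalp p (pt u) *: psi u) uqs _ pws.
  by apply: psi1; rewrite inE sw orbT.
exists (fun v => if v == u then evalp p (pt u) else c v) => v.
rewrite big_cons eqxx opprD addrA big_seq_cond.
rewrite (eq_bigr (fun v => c v *: psi v)) => [|w]; last first.
  by rewrite andbT; case: eqVneq us => // -> /negPf->.
rewrite -big_seq_cond inE => /orP[/eqP->{v}|/cP//].
rewrite !evalpB evalpZ psi1 ?mem_head // mulr1 subrr sub0r evalp_sum.
rewrite big_seq big1 ?oppr0 // => w /(allP psi0) /eqP w0.
by rewrite evalpZ w0 mulr0.
Qed.

Lemma interp_space_supp prec Xi p :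
  {in supp p, forall u, normal_monomial prec (vanishing_ideal Xi) u} ->
  interp_space prec Xi p.
Proof.
move=> sp; exists [seq (p@_m, (m 0, m 1)) | m <- msupp p].
  by move=> _ /mapP[m mp ->]; apply: sp; apply: map_f.
rewrite big_map [LHS]mpolyE; apply: eq_bigr => m _; congr (_ *: _).
rewrite mpolyXE_id !big_ord_recl big_ord0 mulr1 /mon /varx /vary /=.
by congr (_ * 'X_ _ ^+ m _); apply: val_inj.
Qed.

End Interpolation.

(** * Normal monomials and Newton basis for a strict lower set *)

Section StrictLowerSet.
Variables (F : fieldType) (S : {fset nat * nat}) (K : nat) (N : nat -> nat).
Variables (x : nat -> F) (yv : nat -> nat -> F) (c : nat -> nat -> F).
Hypothesis S_mem : forall i j, ((i, j) \in S) = (j < N i)%N.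
(** The truncated predecessor encodes strict decrease while positive and the value 0 from then
    on. *)
Hypothesis N_strict : forall k, (N k.+1 <= (N k).-1)%N.
Hypothesis N_pos : forall k, (0 < N k)%N = (k < K)%N.
Hypothesis x_inj : injective x.
Hypothesis yv_inj : forall i j k,
  (j < N i)%N -> (k < N i)%N -> yv i j = yv i k -> j = k.
Hypothesis cE : forall i j, c i j =
  ((\prod_(s < i) (x i - x s)) * (\prod_(t < j) (yv i j - yv i t)))^-1.

Let pt u : F * F := (x u.1, yv u.1 u.2).
Let psi u : {mpoly F[2]} := c u.1 u.2 *: nodal x u.1 (yv u.1) u.2.
Let Xi : {fset F * F} := [fset pt u | u in S].

(** Yields i - k + j < N k for (i, j) in S and k <= i: a positive left side makes the truncated
    subtraction exact. *)
Lemma N_le k l : (k <= l)%N -> (N l <= N k - (l - k))%N.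
Proof.
elim: l => [|l IHl]; first by rewrite leqn0 => /eqP->; lia.
rewrite leq_eqVlt => /orP[/eqP->|]; first by lia.
by rewrite ltnS => kl; have := IHl kl; have := N_strict l; lia.
Qed.

Lemma S_lower u v : mon_divides u v -> v \in S -> u \in S.
Proof.
case: u v => a b [i j] /andP[/= ai bj]; rewrite !S_mem => jN.
by have := N_le ai; lia.
Qed.

Lemma c_neq0 u : u \in S -> c u.1 u.2 != 0.
Proof.
case: u => i j; rewrite S_mem cE invr_eq0 => jN; apply: mulf_neq0 => /=.
all: apply/prodf_neq0 => s _; rewrite subr_eq0.
  by apply/eqP => /x_inj e; have := ltn_ord s; rewrite -e ltnn.
apply/eqP => /yv_inj e; have := ltn_ord s.
by rewrite -e ?ltnn // (ltn_trans (ltn_ord s)).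
Qed.

(** A lexicographically earlier point lies in an earlier column, where the x-product vanishes, or
    lower in column i, where the y-product does. *)
Lemma nodal_eval_lex i j u : lex u (i, j) ->
  evalp (nodal x i (yv i) j) (pt u) = 0.
Proof.
case: u => a b; rewrite /lex /= => /orP[ai|/andP[/eqP-> bj]].
all: rewrite nodal_eval /=; apply/eqP; rewrite mulf_eq0; apply/orP.
  by left; rewrite (bigD1 (Ordinal ai)) //= subrr mul0r.
by right; rewrite (bigD1 (Ordinal bj)) //= subrr mul0r.
Qed.

Lemma psi_eval u v : v \in S -> (u == v) || lex u v ->
  evalp (psi v) (pt u) = (u == v)%:R.
Proof.
move=> Sv; case: eqVneq => [->|_] /=; rewrite evalpZ; last first.
  by case: v Sv => i j _ /nodal_eval_lex->; rewrite mulr0.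
move=> _; rewrite nodal_eval cE mulVf //.
by have := c_neq0 Sv; rewrite cE invr_eq0.
Qed.

Lemma psi_eval_lt u v : v \in S -> lex u v -> evalp (psi v) (pt u) = 0.
Proof.
move=> Sv uv; rewrite psi_eval ?uv ?orbT //.
have [irr _ _ _] := lex_admissible.
by have [e|//] := eqVneq u v; rewrite e irr in uv.
Qed.

Lemma psi_supp v u : u \in supp (psi v) -> mon_divides u v.
Proof.
rewrite in_supp mcoeffZ mulf_eq0 negb_or => /andP[_]; rewrite -in_supp.
by move/nodal_supp; case: v.
Qed.

Lemma psi_lead_supp v : v \in S -> v \in supp (psi v).
Proof.
by case: v => i j Sv; rewrite in_supp mcoeffZ nodal_lead_coef mulr1 c_neq0.
Qed.

Lemma psi_neq0 v : v \in S -> psi v != 0.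
Proof.
by move/psi_lead_supp; apply: contraTneq => ->; rewrite in_supp mcoeff0 eqxx.
Qed.

(** All monomials of [psi v] divide v, so v leads for every admissible order; the same family is
    thus a chain for both grevlex and lex. *)
Lemma psi_lead prec v : admissible prec -> v \in S -> lead prec (psi v) = v.
Proof.
move=> adm Sv; apply: (lead_unique adm (psi_lead_supp Sv)) => u /psi_supp.
by case: adm => _ _ _ dv uv; case: eqVneq => //= /(dv _ _ uv).
Qed.

Lemma psi_inj : {in S &, injective psi}.
Proof.
move=> u v Su Sv e.
by rewrite -(psi_lead lex_admissible Su) e psi_lead //; apply: lex_admissible.
Qed.

Lemma pt_inj : {in S &, injective pt}.
Proof.
move=> [i j] [m n]; rewrite !S_mem => jN + [/x_inj e].
by rewrite /= -e => nN /yv_inj->.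
Qed.

Lemma lead_notin_S p : vanishing_ideal Xi p -> p != 0 ->
  lead grevlex p \notin S.
Proof.
move=> van p0; apply/negP; have := lead_supp grevlex_admissible p0.
have := @lead_ge _ _ grevlex_admissible p.
case: (lead grevlex p) => i j ub; rewrite in_supp S_mem => /eqP nz jN; case: nz.
rewrite -biv_coef.
(* Column k supplies N k roots on the line x = x(k), more than i - k + j by [N_le]. *)
apply: (vanishing_lead_coef (x := x) (rs := fun k => mkseq (yv k) (N k))) => //.
- move=> k ki; have Nki := N_le ki; rewrite size_mkseq; split; last by lia.
  apply/mkseq_uniqP => a b; rewrite !inE; exact: yv_inj.
- move=> k r ki /mapP[t]; rewrite mem_iota => /= tN ->.
  rewrite -(evalp_biv p (pt (k, t))); apply: van; apply: in_imfset.
  by rewrite S_mem.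
- move=> a b ab; rewrite biv_coef; apply/eqP; apply: contraLR ab.
  by rewrite -in_supp => /ub; rewrite /grevlex xpair_eqE /=; lia.
(* In equal degree grevlex favours the larger power of x, so such a monomial would exceed the
   leading one. *)
- move=> a b ia ab; rewrite biv_coef; apply/eqP; apply: contraLR ia.
  by rewrite -in_supp => /ub; rewrite /grevlex xpair_eqE /=; lia.
Qed.

(* The monomials x^k y^(N k), k <= K, are the minimal ones outside S. *)
Lemma corner_polynomial k : (k <= K)%N -> exists p,
  [/\ vanishing_ideal Xi p, p@_(mnm (k, N k)) = 1 &
    forall u, u \in supp p ->
      u = (k, N k) \/ (u \in S /\ grevlex u (k, N k))].
Proof.
move=> kK; have [s0 s0P s0s] := exists_sorted_perm lex_admissible (fset_uniq S).
have [lex_irr lex_tr lex_tot _] := lex_admissible.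
(* Only columns after k need correcting: [g] below vanishes on column k by its y-factors and on
   earlier columns by its x-factors. *)
pose s := [seq u <- s0 | (k < u.1)%N].
have sS u : (u \in s) = (u \in S) && (k < u.1)%N.
  by rewrite mem_filter andbC (perm_mem s0P).
have us : uniq s by rewrite filter_uniq // (perm_uniq s0P) fset_uniq.
have ss : pairwise lex s.
  by rewrite -sorted_pairwise // sorted_filter.
set g := nodal x k (yv k) (N k).
have [||d dP] := @triangular_interpolation F _ s pt psi g us.
- by move=> u; rewrite sS => /andP[Su _]; rewrite psi_eval ?eqxx.
- apply: (sub_in_pairwise (P := mem s)) ss; last exact/allP.
  move=> u v _; rewrite /= sS => /andP[Sv _] uv.
  by rewrite psi_eval_lt.
(* Hence no [psi v] contains the corner monomial, and the correction leaves its coefficient 1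
   untouched. *)
have corner_nd v : v \in S -> ~~ mon_divides (k, N k) v.
  by move=> Sv; apply/negP => /S_lower/(_ Sv); rewrite S_mem ltnn.
exists (g - \sum_(v <- s) d v *: psi v); split.
- move=> xi /imfsetP[u /= Su ->].
  case: (ltnP k u.1) => uk; first by apply: dP; rewrite sS Su.
  have g0 : evalp g (pt u) = 0.
    apply: nodal_eval_lex; case: u Su uk => a b /=; rewrite S_mem /lex /= => bN.
    by rewrite leq_eqVlt => /orP[/eqP<-|->//]; rewrite eqxx bN orbT.
  rewrite evalpB g0 sub0r evalp_sum big_seq big1 ?oppr0 // => v.
  rewrite sS => /andP[Sv kv].
  have uv : lex u v by rewrite /lex (leq_ltn_trans uk kv).
  by rewrite evalpZ psi_eval_lt ?mulr0.
- rewrite mcoeffB nodal_lead_coef raddf_sum big_seq big1 ?subr0 // => v.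
  rewrite sS => /andP[Sv _] /=; rewrite mcoeffZ.
  suff /eqP-> : (psi v)@_(mnm (k, N k)) == 0 by rewrite mulr0.
  by apply: contraNT (corner_nd v Sv); rewrite -in_supp; apply: psi_supp.
- move=> u up; have [u_g|u_ng] := boolP (u \in supp g).
    (* A proper divisor (a, b) of the corner has smaller degree. It lies in S because b < N k if a =
       k, and b <= N k < N a if a < k. *)
    have := nodal_supp u_g; case: u {up u_g} => a b /andP[/= ak bN].
    case: (eqVneq (a, b) (k, N k)) => [->|ne]; [by left | right].
    rewrite S_mem /grevlex /=; have := N_le ak; have := N_pos a.
    by move: ne; rewrite xpair_eqE; lia.
  right; have /hasP[v] : has (fun v => u \in supp (psi v)) s.
    apply: contraLR up => /hasPn h; rewrite in_supp mcoeffB.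
    move: u_ng; rewrite in_supp negbK => /eqP->.
    rewrite raddf_sum big_seq big1 ?subr0 ?eqxx // => v /h.
    by rewrite in_supp negbK => /eqP h0; rewrite /= mcoeffZ h0 mulr0.
  rewrite sS => /andP[Sv kv] /psi_supp uv; split; first exact: S_lower Sv.
  case: u v {up u_ng} Sv kv uv => a b [i j]; rewrite S_mem /= => jN ki.
  rewrite /mon_divides /grevlex /= => uv.
  (* Here j < N i forces N i > 0, so a + b <= i + j < i + N i <= k + N k. *)
  by have := N_le (ltnW ki); lia.
Qed.

(** The corner polynomials serve as the reduced Groebner basis; as S is lower and contains no
    corner, no leading monomial divides an element of S. *)
Lemma normal_monomial_S u : u \in S ->
  normal_monomial grevlex (vanishing_ideal Xi) u.
Proof.
move=> Su.
have /fin_all_exists[g gP] (k : 'I_K.+1) := @corner_polynomial k (leq_ord k).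
have g_supp (k : 'I_K.+1) : (k : nat, N (k : nat)) \in supp (g k).
  by have [_ g1 _] := gP k; rewrite in_supp g1 oner_neq0.
have g0 (k : 'I_K.+1) : g k != 0.
  by apply: contraTneq (g_supp k) => ->; rewrite in_supp mcoeff0 eqxx.
have g_lead (k : 'I_K.+1) : lead grevlex (g k) = (k : nat, N (k : nat)).
  have [_ _ suppP] := gP k.
  apply: (lead_unique grevlex_admissible (g_supp k)) => v.
  by case/suppP => [->|[_ ->]]; rewrite ?eqxx ?orbT.
have nd (k : 'I_K.+1) v : v \in S -> ~~ mon_divides (lead grevlex (g k)) v.
  by rewrite g_lead => Sv; apply/negP => /S_lower/(_ Sv); rewrite S_mem ltnn.
exists [fset h in [seq g k | k : 'I_K.+1]]; split; last first.
  by move=> h; rewrite !inE => /mapP[k _ ->]; apply: nd.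
split; first split.
- by move=> h; rewrite !inE => /mapP[k _ ->]; have [van _ _] := gP k.
- move=> f fI f0; have := lead_notin_S fI f0.
  case: (lead grevlex f) => a b; rewrite S_mem -leqNgt => Nab.
  (* The corner (a, N a) divides (a, b) if a <= K; beyond that the corner (K, 0) does, since N K =
     0. *)
  have aK : (minn a K < K.+1)%N by rewrite ltnS geq_minr.
  exists (g (Ordinal aK)); first by rewrite !inE map_f ?mem_enum.
  rewrite g_lead /mon_divides /= geq_minl /=; case: (leqP a K) => aK' //.
  by have := N_pos K; lia.
- move=> h; rewrite !inE => /mapP[k _ ->]; have [_ g1 _] := gP k.
  by rewrite /lead_coeff g_lead.
- move=> h1 h2; rewrite !inE => /mapP[k _ ->] /mapP[l _ ->] kl v.
  have [_ _ suppP] := gP k => /suppP[->|[Sv _]]; last exact: nd.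
  rewrite g_lead /mon_divides /=; apply/negP => /andP[lk Nlk].
  have {}kl : (l : nat) != k by apply: contraNneq kl => /val_inj->.
  (* For l < k <= K the height N l is positive, so N k < N l, against divisibility. *)
  by have := N_le lk; have := N_pos l; have := ltn_ord k; lia.
Qed.

(** S is enumerated twice: by grevlex for the chain condition and by lex for triangularity, since
    [psi v] is known at [pt u] when u precedes v lexicographically. *)
Lemma newton_basis_along_psi :
  newton_basis_along grevlex lex Xi [fset psi u | u in S].
Proof.
have chain prec t : admissible prec -> perm_eq t S -> sorted prec t ->
    perm_eq [seq psi u | u <- t] [fset psi u | u in S] /\
    sorted (poly_lt prec) [seq psi u | u <- t].
  move=> adm tS st; split.
    apply: perm_trans (perm_map _ tS) _; rewrite perm_sym.
    by apply: enum_imfset => u v; exact: psi_inj.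
  rewrite sorted_map; apply: (sub_in_sorted (P := mem t)) st; last exact/allP.
  move=> u v; rewrite !(perm_mem tS) => Su Sv uv.
  by rewrite /poly_lt /= !psi_neq0 ?psi_lead.
have cardXi : #|` Xi| = #|` S| by apply/eqP/card_in_imfsetP/pt_inj.
split.
- by rewrite cardXi; apply/eqP/card_in_imfsetP/psi_inj.
- move=> p /imfsetP[v /= Sv ->]; apply: interp_space_supp => u /psi_supp uv.
  by apply: normal_monomial_S; apply: S_lower Sv.
- have [t tS st] := exists_sorted_perm grevlex_admissible (fset_uniq S).
  have [? ?] := chain _ _ grevlex_admissible tS st.
  by exists [seq psi u | u <- t].
have [t tS st] := exists_sorted_perm lex_admissible (fset_uniq S).
have [qP sq] := chain _ _ lex_admissible tS st.
exists [seq pt u | u <- t], [seq psi u | u <- t]; split=> //.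
  apply: perm_trans (perm_map _ tS) _; rewrite perm_sym.
  by apply: enum_imfset => u v; exact: pt_inj.
move=> i j; rewrite cardXi -(perm_size tS) => /andP[ij jt].
have it := leq_ltn_trans ij jt.
have Sn k : (k < size t)%N -> nth (0, 0)%N t k \in S.
  by move=> kt; rewrite -(perm_mem tS) mem_nth.
have ut : uniq t by rewrite (perm_uniq tS) fset_uniq.
rewrite !(nth_map (0, 0)%N) // psi_eval ?nth_uniq ?Sn //.
move: ij; rewrite leq_eqVlt => /orP[->//|ij].
have [_ lex_tr _ _] := lex_admissible.
by rewrite (sorted_ltn_nth lex_tr (0, 0)%N st i j it jt ij) ?orbT.
Qed.

End StrictLowerSet.

(** * Column heights of S_y(Xi) and the theorem *)

Definition height (ns : seq nat) (i : nat) : nat :=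
  if (i < size ns)%N then (nth 0%N ns i).+1 else 0%N.

(** The successor in [height] turns the last index of a column into its cardinality; the default 0
    covers the empty columns past the end. *)
Lemma in_Ly ns i j : ((i, j) \in Ly ns) = (j < height ns i)%N.
Proof.
rewrite !inE /height; apply/allpairsPdep/idP => [[a [b [a_s b_s [-> ->]]]]|].
  by move: a_s b_s; rewrite !mem_iota !add0n => /= ->.
by case: ifP => // ins jn; exists i, j; rewrite !mem_iota !add0n.
Qed.

Lemma height_strict ns k : sorted gtn ns ->
  (height ns k.+1 <= (height ns k).-1)%N.
Proof.
move=> ns_s; rewrite /height; case: ifP => // k1; rewrite (ltnW k1) /=.
by have /(_ k) := (sortedP 0%N ns_s); apply.
Qed.

Lemma height_pos ns k : (0 < height ns k)%N = (k < size ns)%N.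
Proof. by rewrite /height; case: ifP. Qed.

(** Moving left along a row stays in the set down to column 0, where [by_] is the maximum. This
    keeps [inord] in [sig] exact. *)
Lemma Ly_le_by ns u : sorted gtn ns -> u \in Ly ns -> (u.2 <= by_ (Ly ns))%N.
Proof.
move=> ns_s; case: u => i j uS; have jS : (0%N, j) \in Ly ns.
  move: uS; rewrite !in_Ly; elim: i => // i IHi ji; apply: IHi.
  by have := height_strict i ns_s; lia.
exact: (leq_bigmax_seq (F := snd) (0%N, j) jS).
Qed.

Theorem theorem3p3 (F : fieldType) (Xi : {fset F * F}) (x y : nat -> F)
    (sigma : 'I_(bx (Sy Xi)).+1 -> 'S_(by_ (Sy Xi)).+1)
    (hXi : y_tower Xi) (hform : y_tower_form x y sigma) :
  newton_basis_along grevlex lex Xi (newton_family x y sigma (Sy Xi)) /\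
  (forall i j m n : nat,
     (i, j) \in Sy Xi -> (m, n) \in Sy Xi ->
     ((m, n) == (i, j)) || lex (m, n) (i, j) ->
     evalp (phi x y sigma i j) (x m, y (sig sigma m n)) =
       ((i, j) == (m, n))%:R).
Proof.
case: hXi => _ [ns [_ SE ns_s]] _; case: hform => x_inj y_inj XiE.
have S_mem i j : ((i, j) \in Sy Xi) = (j < height ns i)%N by rewrite SE in_Ly.
have le_by u : u \in Sy Xi -> (u.2 <= by_ (Sy Xi))%N.
  by rewrite SE; apply: Ly_le_by.
pose yv i j := y (sig sigma i j).
have yv_inj i j k : (j < height ns i)%N -> (k < height ns i)%N ->
    yv i j = yv i k -> j = k.
  (* Both indices are at most [by_], where [inord] is injective; y and the permutation are injective
     too. *)
  rewrite -!S_mem => /le_by jb /le_by kb /y_inj/val_inj/perm_inj.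
  by move/(congr1 val); rewrite /= !inordK.
have N_strict k := height_strict k ns_s.
split.
  (* Only the point set is rewritten, since the type of [sigma] depends on [Xi]. With
     [c := phi_coeff] the [psi] of the section unfold to the [phi]. *)
  rewrite [X in newton_basis_along _ _ X _]XiE.
  exact: (newton_basis_along_psi (c := phi_coeff x y sigma) S_mem N_strict
    (height_pos ns) x_inj yv_inj).
move=> i j m n Sij _ le_mn; rewrite eq_sym.
exact: (psi_eval (c := phi_coeff x y sigma) S_mem x_inj yv_inj _ Sij le_mn).
Qed.
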